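(* Let $d\ge 1$ and let $\mathbf{u},\mathbf{v}\in\mathbb{R}^d$ with $\mathbf{u}\cdot\mathbf{v}\ne 0$. Then $$|\mathrm{decos}(\mathbf{u},\mathbf{v})|\;\le\;|\cos(\mathbf{u},\mathbf{v})|\;\le\;|\mathrm{recos}(\mathbf{u},\mathbf{v})|,$$ and the equality conditions are as follows. (1) $|\mathrm{recos}(\mathbf{u},\mathbf{v})|=|\cos(\mathbf{u},\mathbf{v})|$ if and only if there exist a scalar $k\in\mathbb{R}$ and a $d\times d$ permutation matrix $P$ such that $\mathbf{v}=kP\mathbf{u}$ and $\operatorname{sgn}(\mathbf{u}\cdot\mathbf{v})=\operatorname{sgn}(k)$. (2) $|\mathrm{recos}(\mathbf{u},\mathbf{v})|=|\mathrm{decos}(\mathbf{u},\mathbf{v})|$ if and only if there exist a scalar $k\in\{1,-1\}$ and a $d\times d$ permutation matrix $P$ such that $\mathbf{v}=kP\mathbf{u}$ and $\operatorname{sgn}(\mathbf{u}\cdot\mathbf{v})=\operatorname{sgn}(k)$. (3) $|\cos(\mathbf{u},\mathbf{v})|=|\mathrm{decos}(\mathbf{u},\mathbf{v})|$ if and only if $\|\mathbf{u}\|=\|\mathbf{v}\|$.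
   Context: For $\mathbf{u}=(u_1,\dots,u_d)$, $\mathbf{v}=(v_1,\dots,v_d)$ in $\mathbb{R}^d$, $\mathbf{u}\cdot\mathbf{v}=\sum_{i=1}^d u_iv_i$ and $\|\mathbf{u}\|=\sqrt{\sum_{i=1}^d u_i^2}$. For a vector $\mathbf{w}\in\mathbb{R}^d$, $\mathbf{w}^{\uparrow}$ denotes the vector obtained by sorting the components of $\mathbf{w}$ in non-decreasing order, and $\mathbf{w}^{\downarrow}$ the vector obtained by sorting them in non-increasing order. Given $\mathbf{u},\mathbf{v}$ with $\mathbf{u}\cdot\mathbf{v}\ne 0$, the vector $\mathbf{v}^{\updownarrow}$ (which depends on $\mathbf{u}$ as well) is defined as $\mathbf{v}^{\updownarrow}=\mathbf{v}^{\uparrow}$ if $\mathbf{u}\cdot\mathbf{v}>0$ and $\mathbf{v}^{\updownarrow}=\mathbf{v}^{\downarrow}$ if $\mathbf{u}\cdot\mathbf{v}<0$. For $\mathbf{u}\cdot\mathbf{v}\neq 0$ define $$\mathrm{recos}(\mathbf{u},\mathbf{v})=\frac{\mathbf{u}\cdot\mathbf{v}}{|\mathbf{u}^{\uparrow}\cdot\mathbf{v}^{\updownarrow}|},\qquad \cos(\mathbf{u},\mathbf{v})=\frac{\mathbf{u}\cdot\mathbf{v}}{\|\mathbf{u}\|\|\mathbf{v}\|},\qquad \mathrm{decos}(\mathbf{u},\mathbf{v})=\frac{\mathbf{u}\cdot\mathbf{v}}{\frac12(\|\mathbf{u}\|^2+\|\mathbf{v}\|^2)}.$$ *)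

(* Defs.v *)
From HB Require Import structures.
From mathcomp Require Import all_boot all_order all_algebra.
From mathcomp Require Import reals.

Set Implicit Arguments.
Unset Strict Implicit.
Unset Printing Implicit Defensive.

Import Order.TTheory GRing.Theory Num.Theory.
Local Open Scope ring_scope.

Section Similarity.
Context {R : realType} {d : nat}.
Implicit Types u v w : 'cV[R]_d.

Definition dot u v : R := \sum_(i < d) u i 0 * v i 0.

(* Not the library norm `|u| on matrices, which is the sup norm. *)
Definition enorm u : R := Num.sqrt (\sum_(i < d) u i 0 ^+ 2).

Definition components w : seq R := [seq w i 0 | i <- enum 'I_d].

(* The sorted sequence has size d, so the default value 0 of nth is never used. *)
Definition sort_up w : 'cV[R]_d :=
  \col_(i < d) nth 0 (sort <=%R (components w)) i.
Definition sort_down w : 'cV[R]_d :=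
  \col_(i < d) nth 0 (sort >=%R (components w)) i.

(* Only meaningful when dot u v != 0; the value when dot u v = 0 is arbitrary. *)
Definition sort_updown u v : 'cV[R]_d :=
  if 0 < dot u v then sort_up v else sort_down v.

Definition recos u v : R := dot u v / `|dot (sort_up u) (sort_updown u v)|.
Definition cosine u v : R := dot u v / (enorm u * enorm v).
Definition decos u v : R :=
  dot u v / (2^-1 * (enorm u ^+ 2 + enorm v ^+ 2)).

End Similarity.

(* Main.v *)
(* The three quantities share the numerator |u.v|, and their denominators satisfy
   |u^up . v^updown| <= |u||v| <= (|u|^2 + |v|^2)/2 by Cauchy-Schwarz and AM-GM.
   The rearrangement inequality makes the first denominator positive.  Equality
   in Cauchy-Schwarz says that the sorted vectors are proportional, i.e. that v
   is a multiple of a permutation of u. *)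
Require Import Defs.
From HB Require Import structures.
From mathcomp Require Import all_boot all_order all_algebra.
From mathcomp Require Import reals.
From mathcomp Require Import fingroup perm ring lra.

Set Implicit Arguments.
Unset Strict Implicit.
Unset Printing Implicit Defensive.

Import Order.TTheory GRing.Theory Num.Theory.
Local Open Scope ring_scope.

(** * The rearrangement inequality for sequences *)

Section SeqRearrangement.
Context {R : realDomainType}.
Implicit Types a w : seq R.

Fixpoint dotseq a w : R :=
  match a, w with
  | x :: a', y :: w' => x * y + dotseq a' w'
  | _, _ => 0
  end.

Lemma dotseq_cons x a y w : dotseq (x :: a) (y :: w) = x * y + dotseq a w.
Proof. by []. Qed.

Lemma dotseq_nth n a w : size a = n -> size w = n ->
  dotseq a w = \sum_(i < n) a`_i * w`_i.
Proof.
elim: n a w => [|n IHn] [|x a] [|y w] //=; first by rewrite big_ord0.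
by move=> [sa] [sw]; rewrite big_ord_recl (IHn _ _ sa sw).
Qed.

(** Each time [y] moves right past a smaller [z], the terms [x * y + x' * z] become
    [x * z + x' * y], a gain of [(x' - x) * (y - z)]. Here [w] may be unsorted: the merge puts [y]
    before the first entry that is at least [y]. *)
Lemma dotseq_insert x a y w : sorted <=%R (x :: a) -> size a = size w ->
  dotseq (x :: a) (y :: w) <= dotseq (x :: a) (merge <=%R [:: y] w).
Proof.
elim: a x w => [|x' a IHa] x [|z w] // /andP[lexx' sa] [saw].
case: (leP y z) => ltzy; first by rewrite [merge _ _ _]/= ltzy.
have -> : merge <=%R [:: y] (z :: w) = z :: merge <=%R [:: y] w.
  by rewrite /= leNgt ltzy.
move: (IHa x' w sa saw); rewrite !dotseq_cons.
have : 0 <= (x' - x) * (y - z) by rewrite mulr_ge0 ?subr_ge0 // ltW.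
by move: (dotseq _ (merge _ _ _)) => m; lra.
Qed.

(* Insertion sort never decreases the product with a sorted sequence. *)
Lemma dotseq_sort a w : sorted <=%R a -> size a = size w ->
  dotseq a w <= dotseq a (sort <=%R w).
Proof.
elim: a w => [|x a IHa] [|y w] // sa [saw].
(* The library sort is a merge sort; it agrees with insertion because a sequence has only one sorted
   rearrangement. *)
have -> : sort <=%R (y :: w) = merge <=%R [:: y] (sort <=%R w).
  apply: (sorted_eq le_trans le_anti); rewrite ?sort_le_sorted //.
    by apply: merge_sorted => //; [exact: le_total | exact: sort_le_sorted].
  by rewrite perm_sort perm_sym perm_merge /= perm_cons perm_sort.
apply: le_trans (dotseq_insert _ sa _); last by rewrite size_sort.
by rewrite /= lerD2l IHa // (path_sorted sa).
Qed.

End SeqRearrangement.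

(** * Dot product, Euclidean norm and Cauchy-Schwarz *)

Section Vectors.
Context {R : realType} {d : nat}.
Implicit Types u v w : 'cV[R]_d.

Lemma dotC u v : dot u v = dot v u.
Proof. by apply: eq_bigr => i _; rewrite mulrC. Qed.

Lemma dotZr c u v : dot u (c *: v) = c * dot u v.
Proof. by rewrite /dot mulr_sumr; apply: eq_bigr => i _; rewrite mxE mulrCA. Qed.

Lemma dot_mx u v : dot u v = (u^T *m v) 0 0.
Proof. by rewrite mxE; apply: eq_bigr => i _; rewrite mxE. Qed.

Lemma enormE u : enorm u = Num.sqrt (dot u u).
Proof. by congr Num.sqrt; apply: eq_bigr => i _; rewrite expr2. Qed.

Lemma dot_ge0 u : 0 <= dot u u.
Proof. by apply: sumr_ge0 => i _; rewrite -expr2 sqr_ge0. Qed.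

Lemma enorm_ge0 u : 0 <= enorm u. Proof. exact: sqrtr_ge0. Qed.

Lemma sqr_enorm u : enorm u ^+ 2 = dot u u.
Proof. by rewrite enormE sqr_sqrtr ?dot_ge0. Qed.

Lemma dot_eq0 u : (dot u u == 0) = (u == 0).
Proof.
apply/eqP/eqP => [u0|->]; last by apply: big1 => i _; rewrite mxE mul0r.
apply/colP => i; apply/eqP; rewrite mxE -sqrf_eq0 expr2.
by apply/eqP; apply: (psumr_eq0P _ u0) => // j _; rewrite -expr2 sqr_ge0.
Qed.

Lemma enorm_gt0 u v : dot u v != 0 -> 0 < enorm u.
Proof.
move=> uv0; rewrite lt_def enorm_ge0 andbT; apply: contraNneq uv0 => nu0.
have /eqP : dot u u = 0 by rewrite -sqr_enorm nu0 expr0n.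
by rewrite dot_eq0 => /eqP ->; apply/eqP/big1 => i _; rewrite mxE mul0r.
Qed.

Lemma enormZ c u : enorm (c *: u) = `|c| * enorm u.
Proof.
rewrite !enormE dotZr dotC dotZr mulrA -expr2.
by rewrite sqrtrM ?sqr_ge0 // sqrtr_sqr.
Qed.

(** The two square terms of the expansion both equal [(enorm u * enorm v) ^+ 2]. As the left side is
    a squared norm, this yields Cauchy-Schwarz and its equality case together. *)
Lemma dot_lagrange u v :
  dot (enorm v *: u - enorm u *: v) (enorm v *: u - enorm u *: v) =
  2 * (enorm u * enorm v) * (enorm u * enorm v - dot u v).
Proof.
set a := enorm u; set b := enorm v.
transitivity (b ^+ 2 * dot u u - 2 * a * b * dot u v + a ^+ 2 * dot v v).
  rewrite /dot !mulr_sumr -sumrB -big_split; apply: eq_bigr => i _.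
  by rewrite !mxE /=; ring.
by rewrite -!sqr_enorm -/a -/b; ring.
Qed.

Lemma dot_le_enorm u v : dot u v <= enorm u * enorm v.
Proof.
case: (leP (dot u v) 0) => [le0|gt0].
  by apply: le_trans le0 _; rewrite mulr_ge0 ?enorm_ge0.
have uv0 : dot u v != 0 by rewrite gt_eqF.
have nu := enorm_gt0 uv0; have nv : 0 < enorm v by rewrite (@enorm_gt0 _ u) // dotC.
have := dot_ge0 (enorm v *: u - enorm u *: v).
by rewrite dot_lagrange pmulr_rge0 ?subr_ge0 // !mulr_gt0.
Qed.

Lemma dot_eq_enorm u v : 0 < enorm u -> dot u v = enorm u * enorm v ->
  v = (enorm v / enorm u) *: u.
Proof.
move=> nu E; have /eqP := dot_lagrange u v.
rewrite E subrr mulr0 dot_eq0 subr_eq0 => /eqP F.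
by rewrite mulrC -scalerA F scalerA mulVf ?gt_eqF // scale1r.
Qed.

(** * Components, permutations and sorting *)

Lemma size_components w : size (components w) = d.
Proof. by rewrite size_map size_enum_ord. Qed.

Lemma nth_components w (i : 'I_d) : (components w)`_i = w i 0.
Proof. by rewrite (nth_map i) ?size_enum_ord // nth_ord_enum. Qed.

Lemma componentsZ c w : components (c *: w) = map ( *%R c) (components w).
Proof. by rewrite -map_comp; apply: eq_map => i /=; rewrite mxE. Qed.

Lemma components_sort_up w : components (sort_up w) = sort <=%R (components w).
Proof.
apply: (@eq_from_nth _ 0) => [|i]; rewrite size_components.
  by rewrite size_sort size_components.
by move=> lt_id; rewrite (nth_components _ (Ordinal lt_id)) mxE.
Qed.

Lemma perm_componentsP u w :
  reflect (exists2 P : 'M[R]_d, is_perm_mx P & u = P *m w)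
          (perm_eq (components u) (components w)).
Proof.
have tP (x : 'cV[R]_d) : size (components x) == d by rewrite size_components.
(* Seen as a tuple, the second sequence falls under [tuple_permP], which provides a permutation of
   the indices. *)
have -> : perm_eq (components u) (components w) =
          perm_eq (components u) (Tuple (tP w)) by [].
have tE x (i : 'I_d) : tnth (Tuple (tP x)) i = x i 0.
  by rewrite (tnth_nth 0) nth_components.
apply: (iffP tuple_permP) => [[s E]|[P /is_perm_mxP[s ->] ->]].
  exists (perm_mx s); first exact: perm_mx_is_perm.
  apply/colP => i; rewrite -row_permE mxE -nth_components E.
  by rewrite (nth_map i) ?size_enum_ord // nth_ord_enum tE.
exists s; rewrite /components; apply: eq_map => i.
by rewrite -row_permE mxE tE.
Qed.

Lemma sort_up_perm u w :
  perm_eq (components u) (components w) -> sort_up u = sort_up w.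
Proof. by move=> /perm_sort_leP E; apply/colP => i; rewrite !mxE E. Qed.

Lemma sort_upP w : exists2 P : 'M[R]_d, is_perm_mx P & w = P *m sort_up w.
Proof.
by apply/perm_componentsP; rewrite components_sort_up perm_sym perm_sort.
Qed.

(** Scaling by [c >= 0] keeps a sorted sequence sorted, and sorted rearrangements are unique. *)
Lemma sort_upZ c w : 0 <= c -> sort_up (c *: w) = c *: sort_up w.
Proof.
move=> c0; apply/colP => i; rewrite -!nth_components componentsZ.
congr (nth 0 _ i); rewrite !components_sort_up componentsZ.
apply: (sorted_eq le_trans le_anti); first exact: sort_le_sorted.
  apply: (homo_sorted (e := <=%R)); last exact: sort_le_sorted.
  by move=> x y; exact: ler_wpM2l.
by rewrite perm_sort perm_map // perm_sym perm_sort.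
Qed.

(** Negation reverses the order, so everything about decreasing sorts follows from increasing
    ones. *)
Lemma sort_downE w : sort_down w = - sort_up (- w).
Proof.
rewrite -!scaleN1r; apply/colP => i; rewrite -!nth_components !componentsZ.
have -> : components (sort_down w) = sort >=%R (components w).
  apply: (@eq_from_nth _ 0) => [|j]; rewrite size_components.
    by rewrite size_sort size_components.
  by move=> lt_jd; rewrite (nth_components _ (Ordinal lt_jd)) mxE.
congr (nth 0 _ i); rewrite components_sort_up componentsZ.
apply: (sorted_eq ge_trans ge_anti).
- by apply: sort_sorted; exact: ge_total.
- apply: (homo_sorted (e := <=%R)); last exact: sort_le_sorted.
  by move=> x y /= lexy; rewrite !mulN1r lerN2.
rewrite perm_sort -{1}[components w]map_id.
rewrite (@eq_map _ _ id ( *%R (-1) \o *%R (-1))); last first.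
  by move=> x /=; rewrite mulrA mulrNN !mul1r.
by rewrite map_comp perm_map // perm_sym perm_sort.
Qed.

(** * Permutation matrices as isometries, and rearrangement of vectors *)

Lemma is_perm_mx_trmxK (P : 'M[R]_d) : is_perm_mx P -> P^T *m P = 1%:M.
Proof.
by move=> /is_perm_mxP[s ->]; rewrite tr_perm_mx -perm_mxM mulVg perm_mx1.
Qed.

Lemma dot_perm_mx (P : 'M[R]_d) u v :
  is_perm_mx P -> dot (P *m u) (P *m v) = dot u v.
Proof.
move=> HP; rewrite !dot_mx trmx_mul -mulmxA (mulmxA P^T).
by rewrite is_perm_mx_trmxK // mul1mx.
Qed.

Lemma enorm_perm_mx (P : 'M[R]_d) u : is_perm_mx P -> enorm (P *m u) = enorm u.
Proof. by move=> HP; rewrite !enormE dot_perm_mx. Qed.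

Lemma enorm_sort_up w : enorm (sort_up w) = enorm w.
Proof. by have [P HP E] := sort_upP w; rewrite [in RHS]E enorm_perm_mx. Qed.

(** Permuting both vectors by the permutation that sorts [u] changes neither the product nor
    [sort_up v]; with [u] sorted, [dotseq_sort] applies. *)
Lemma rearrangement u v : dot u v <= dot (sort_up u) (sort_up v).
Proof.
have [P HP uE] := sort_upP u.
have HPt : is_perm_mx P^T by rewrite is_perm_mx_tr.
have -> : dot u v = dot (sort_up u) (P^T *m v).
  by rewrite -(dot_perm_mx _ _ HPt) [in LHS]uE mulmxA is_perm_mx_trmxK // mul1mx.
have <- : sort_up (P^T *m v) = sort_up v.
  by apply/sort_up_perm/perm_componentsP; exists P^T.
move: (P^T *m v) => w.
have dotE (x y : 'cV[R]_d) : dot x y = dotseq (components x) (components y).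
  rewrite (@dotseq_nth _ d) ?size_components //.
  by apply: eq_bigr => i _; rewrite !nth_components.
rewrite !dotE (components_sort_up w) dotseq_sort ?size_components //.
by rewrite components_sort_up sort_le_sorted.
Qed.

(* Multiplying v by the sign of u.v reduces both cases of v^updown to the
   increasing one. *)
Lemma dot_sort_updown u v : dot u v != 0 ->
  `|dot (sort_up u) (sort_updown u v)| =
  dot (sort_up u) (sort_up (Num.sg (dot u v) *: v)).
Proof.
move=> uv0; have := rearrangement u (Num.sg (dot u v) *: v).
rewrite dotZr -normrEsg.
move/(le_trans (normr_ge0 _)) => ge0; rewrite -{}[RHS]ger0_norm // /sort_updown.
case: (ltgtP (dot u v) 0) uv0 => // [lt0|gt0] _.
  by rewrite ltr0_sg // sort_downE -scaleN1r dotZr scaleN1r normrM normrN1 mul1r.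
by rewrite gtr0_sg // scale1r.
Qed.

(** This is the equality case of Cauchy-Schwarz for the sorted vectors, which have the same norms as
    [u] and [v]. *)
Lemma sort_up_homothetyP u v : 0 < dot u v ->
  dot (sort_up u) (sort_up v) = enorm u * enorm v <->
  exists c (P : 'M[R]_d), [/\ 0 < c, is_perm_mx P & v = c *: (P *m u)].
Proof.
move=> uv0; have uvN0 : dot u v != 0 by rewrite gt_eqF.
have nu := enorm_gt0 uvN0.
have nv : 0 < enorm v by rewrite (@enorm_gt0 _ u) // dotC.
split=> [E|[c [P [c0 HP vE]]]].
  have := @dot_eq_enorm (sort_up u) (sort_up v).
  rewrite !enorm_sort_up => /(_ nu E) vE.
  have [P HP vP] := sort_upP v; have [Q HQ uQ] := sort_upP u.
  (* [Q^T] sorts [u], the ratio of norms scales [sort_up u] to [sort_up v], and [P] restores [v]. *)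
  exists (enorm v / enorm u), (P *m Q^T); split; first exact: divr_gt0.
    by rewrite is_perm_mxMl ?is_perm_mx_tr.
  rewrite [LHS]vP vE -scalemxAr -mulmxA.
  by congr (_ *: (_ *m _)); rewrite [in RHS]uQ mulmxA is_perm_mx_trmxK // mul1mx.
have -> : sort_up v = c *: sort_up u.
  rewrite vE sort_upZ ?ltW //; congr (_ *: _).
  by apply/sort_up_perm/perm_componentsP; exists P.
rewrite vE enormZ enorm_perm_mx // (gtr0_norm c0) dotZr.
by rewrite -sqr_enorm enorm_sort_up expr2 mulrCA.
Qed.

End Vectors.

(** * Comparison of the three denominators *)

Lemma eq_pdivl (F : realFieldType) (x a b : F) :
  0 < x -> 0 < a -> 0 < b -> x / a = x / b <-> a = b.
Proof.
move=> x0 a0 b0; split=> [|-> //].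
by move/(mulfI (lt0r_neq0 x0))/invr_inj.
Qed.

Theorem corollary2 (R : realType) (d : nat) (hd : (1 <= d)%N)
    (u v : 'cV[R]_d) (huv : dot u v <> 0) :
  (`|decos u v| <= `|cosine u v| /\ `|cosine u v| <= `|recos u v|) /\
  (`|recos u v| = `|cosine u v| <->
     exists (k : R) (P : 'M[R]_d),
       [/\ is_perm_mx P, v = k *: (P *m u) & Num.sg (dot u v) = Num.sg k]) /\
  (`|recos u v| = `|decos u v| <->
     exists (k : R) (P : 'M[R]_d),
       [/\ k = 1 \/ k = -1, is_perm_mx P, v = k *: (P *m u)
         & Num.sg (dot u v) = Num.sg k]) /\
  (`|cosine u v| = `|decos u v| <-> enorm u = enorm v).
Proof.
move/eqP: huv => uv0.
(* Replacing [v] by [s *: v] makes the product positive and keeps the norm. *)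
set s := Num.sg (dot u v).
have xgt0 : 0 < `|dot u v| by rewrite normr_gt0.
have suv : dot u (s *: v) = `|dot u v| by rewrite dotZr -normrEsg.
have ns : `|s| = 1 by rewrite normr_sg uv0.
have ss : s * s = 1 by rewrite -expr2 sqr_sg uv0.
have nsv : enorm (s *: v) = enorm v by rewrite enormZ ns mul1r.
have nu := enorm_gt0 uv0.
have nv : 0 < enorm v by rewrite (@enorm_gt0 _ _ _ u) // dotC.
set D := dot (sort_up u) (sort_up (s *: v)).
have recosE : `|recos u v| = `|dot u v| / D.
  by rewrite /recos normrM normfV normr_id dot_sort_updown.
have D0 : 0 < D by apply: lt_le_trans (rearrangement _ _); rewrite suv.
have DC : D <= enorm u * enorm v.
  by rewrite -nsv -enorm_sort_up -(enorm_sort_up (s *: v)) dot_le_enorm.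
have C0 : 0 < enorm u * enorm v by rewrite mulr_gt0.
have cosE : `|cosine u v| = `|dot u v| / (enorm u * enorm v).
  by rewrite /cosine normrM normfV (gtr0_norm C0).
set M := 2^-1 * (enorm u ^+ 2 + enorm v ^+ 2).
(* The gap in AM-GM is half a square, which gives both the inequality and its equality case. *)
have ME : M - enorm u * enorm v = 2^-1 * (enorm u - enorm v) ^+ 2.
  by rewrite /M; field.
have CM : enorm u * enorm v <= M.
  by rewrite -subr_ge0 ME mulr_ge0 ?sqr_ge0 // invr_ge0.
have M0 : 0 < M by apply: lt_le_trans CM.
have decosE : `|decos u v| = `|dot u v| / M.
  by rewrite /decos normrM normfV (gtr0_norm M0).
have le_div a b : 0 < a -> a <= b -> `|dot u v| / b <= `|dot u v| / a.
  by move=> a0 ab; rewrite ler_pM2l // lef_pV2 // posrE (lt_le_trans a0).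
have part1 : D = enorm u * enorm v <-> exists (k : R) (P : 'M[R]_d),
    [/\ is_perm_mx P, v = k *: (P *m u) & s = Num.sg k].
  have gt0 : 0 < dot u (s *: v) by rewrite suv.
  rewrite -nsv; apply: iff_trans (sort_up_homothetyP gt0) _.
  split=> [[c [P [c0 HP E]]]|[k [P [HP vE sk]]]].
    (* Since [s * s = 1], [s *: v = c *: (P *m u)] means that [v] has factor [k = s * c], whose sign
       is [s] as [c > 0]. *)
    exists (s * c), P; split=> //; first by rewrite -scalerA -E scalerA ss scale1r.
    by rewrite sgrM (gtr0_sg c0) mulr1 sgr_id.
  (* Conversely [s * k] is the absolute value of [k], nonzero because [s] is. *)
  exists (s * k), P; split=> //; last by rewrite {1}vE scalerA.
  by rewrite sk -normrEsg normr_gt0 -sgr_eq0 -sk -normr_gt0 ns.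
have part3 : enorm u * enorm v = M <-> enorm u = enorm v.
  split=> [E|E]; last by rewrite /M E; field.
  move/eqP: ME; rewrite E subrr eq_sym mulf_eq0 invr_eq0 pnatr_eq0 /=.
  by rewrite sqrf_eq0 subr_eq0 => /eqP.
rewrite recosE cosE decosE; split; first by rewrite !le_div.
split; first exact: iff_trans (eq_pdivl xgt0 D0 C0) part1.
split; last exact: iff_trans (eq_pdivl xgt0 C0 M0) part3.
apply: iff_trans (eq_pdivl xgt0 D0 M0) _; split.
  (* [D = M] squeezes the middle denominator, so both other equality cases hold. *)
  move=> DM; have CD : D = enorm u * enorm v by apply/le_anti; rewrite DC DM CM.
  have /part3 uv : enorm u * enorm v = M by rewrite -CD.
  have /part1[k [P [HP vE sk]]] := CD; exists k, P; split=> //.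
  (* Equal norms of [u] and [v = k *: (P *m u)] force this, as [P] preserves the norm. *)
  have k1 : `|k| = 1.
    apply: (mulIf (lt0r_neq0 nu)).
    by rewrite mul1r [in RHS]uv [in RHS]vE enormZ enorm_perm_mx.
  by move/eqP: k1; rewrite eqr_norml ler01 andbT => /orP[]/eqP; [left | right].
move=> [k [P [k1 HP vE sk]]].
have -> : D = enorm u * enorm v by apply/part1; exists k, P.
apply/part3; rewrite vE enormZ enorm_perm_mx //.
by case: k1 => ->; rewrite ?normrN normr1 mul1r.
Qed.
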